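(* Let $q\ge 1$ be an integer, let $G$ be a finite graph with an interaction energy $J_e$ at each edge $e$, equipped with a field vector $\boldsymbol{M}_i=(M_{i,1},\ldots,M_{i,q})\in\mathbb{C}^q$ at each vertex $v_i$. Then the $q$-state Potts model partition function $Z_{ext}(G)$ with variable edge interaction energies and variable field satisfies \[ Z_{ext}(G)=\sum_{\pi\in\mathcal{P}(G)} X(\pi)\prod_{H\in\mathcal{C}(\pi)}[q^1]\left(Z_{zero}\big(H;q,\{\mathrm{e}^{\beta J_e}-1\}_{e\in E(H)}\big)\right), \] where $\mathcal{P}(G)$ is the set of connected partitions of $V(G)$ and, for each connected partition $\pi=(V_1,\ldots,V_k)$, $\mathcal{C}(\pi)$ is the set of subgraphs of $G$ induced by $\pi$; $X(\pi)=X_{\boldsymbol{V}_1}\cdots X_{\boldsymbol{V}_k}$, where $X_{\boldsymbol{M}}=\sum_{\alpha=1}^q \mathrm{e}^{\beta M_\alpha}$ for $\boldsymbol{M}=(M_1,\ldots,M_q)\in\mathbb{C}^q$, and $\boldsymbol{V}_i$ is the sum of the weights $\boldsymbol{M}_j$ of all of the vertices $v_j$ in $V_i$.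
   Context: Graphs are finite and may have loops and multiple edges; $V(G)=\{v_1,\ldots,v_n\}$ and $E(G)$ are the vertex and edge sets. $\beta$ is a fixed constant and each edge $e=\{v_i,v_j\}$ carries an interaction energy $J_e=J_{i,j}$ ($\beta$ and the $J_e$ may be taken to be complex numbers). A state of $G$ is a function $\sigma:V(G)\to\{1,\ldots,q\}$; $\sigma_i=\sigma(v_i)$; $\mathcal{S}(G)$ is the set of states; $\delta$ is the Kronecker delta. With the Hamiltonian $h(\sigma)=-\sum_{\{i,j\}\in E(G)}J_{i,j}\,\delta(\sigma_i,\sigma_j)-\sum_{v_i\in V(G)}\sum_{\alpha=1}^q M_{i,\alpha}\,\delta(\alpha,\sigma_i)$, the partition function is $Z_{ext}(G)=\sum_{\sigma\in\mathcal{S}(G)}\mathrm{e}^{-\beta h(\sigma)}$. $Z_{zero}$ denotes the zero-field partition function, i.e. the sum $\sum_{\sigma}\mathrm{e}^{-\beta h(\sigma)}$ with $h(\sigma)=-\sum_{\{i,j\}\in E}J_{i,j}\,\delta(\sigma_i,\sigma_j)$. For a graph $H$, it is regarded as a polynomial in the number of spins $q$ and in the quantities $\gamma_e=\mathrm{e}^{\beta J_e}-1$, namely $Z_{zero}(H;q,\{\gamma_e\}_{e\in E(H)})=\sum_{A\subseteq E(H)}q^{k(A)}\prod_{e\in A}\gamma_e$, where $k(A)$ is the number of connected components of the spanning subgraph $(V(H),A)$. $[q^1]$ extracts the coefficient of $q^1$ in this polynomial, with $q$ treated as an indeterminate inside the bracket and the $\gamma_e$ as constants. A partition $\pi=(V_1,\ldots,V_k)$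 of $V(G)$ is a connected partition if, for each $i$, the subgraph $G_i$ of $G$ induced by $V_i$ (vertex set $V_i$ and all edges of $G$ with both ends in $V_i$) is connected. $\mathcal{C}(\pi)=\{G_1,\ldots,G_k\}$. Partitions are unordered. *)

(* Defs.v *)
From mathcomp Require Import all_boot all_order all_algebra.
From mathcomp Require Import reals sequences exp trigo.
From mathcomp Require Export complex.

Set Implicit Arguments.
Unset Strict Implicit.
Unset Printing Implicit Defensive.

Import GRing.Theory Num.Theory.
Local Open Scope ring_scope.

(* Edges are abstract elements, so parallel edges and loops (equal end points)
   are allowed. The two end points of an edge are stored as an ordered pair,
   but nothing below depends on their order. *)
Record mgraph : Type := MGraph {
  vert : finType;
  edge : finType;
  ends : edge -> vert * vert
}.

Section Graph.
Variable G : mgraph.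

(* Adjacency in the spanning subgraph (V(G), A). *)
Definition adj (A : {set edge G}) : rel (vert G) :=
  fun x y => [exists e in A, (ends e == (x, y)) || (ends e == (y, x))].

Definition num_comp (A : {set edge G}) : nat := n_comp (adj A) (vert G).

Definition connected_graph : bool := num_comp [set: edge G] == 1%N.

Variable S : {set vert G}.

Definition induced_vert : finType := {x : vert G | x \in S}.

Definition inner_edge (e : edge G) : bool :=
  ((ends e).1 \in S) && ((ends e).2 \in S).

Definition induced_edge : finType := {e : edge G | inner_edge e}.

Definition induced_ends (e : induced_edge) : induced_vert * induced_vert :=
  let: conj h1 h2 := andP (valP e) in
  (exist _ (ends (val e)).1 h1, exist _ (ends (val e)).2 h2).

Definition induced : mgraph := MGraph induced_ends.

Definition edge_of_induced (e : edge induced) : edge G := val (e : induced_edge).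

End Graph.

(* Blocks of a [partition] are nonempty and the partition is a set of blocks,
   hence unordered. *)
Definition connected_partition (G : mgraph) (P : {set {set vert G}}) : bool :=
  partition P [set: vert G] && [forall V in P, connected_graph (induced V)].

Section Potts.
Variable R : realType.
Local Notation C := (complex R).

Definition cexp (z : C) : C :=
  Complex (expR (complex.Re z) * cos (complex.Im z)) (expR (complex.Re z) * sin (complex.Im z)).

Section Field.
Variables (G : mgraph) (q : nat) (beta : C).
Variables (J : edge G -> C) (M : vert G -> 'rV[C]_q).

Definition hamiltonian (s : {ffun vert G -> 'I_q}) : C :=
  - \sum_(e : edge G) J e * (s (ends e).1 == s (ends e).2)%:R
  - \sum_(v : vert G) \sum_(a < q) M v 0 a * (a == s v)%:R.

Definition Zext : C :=
  \sum_(s : {ffun vert G -> 'I_q}) cexp (- beta * hamiltonian s).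

End Field.

(* Fortuin-Kasteleyn (spanning subgraph) form of the zero-field partition
   function: gamma e stands for exp (beta * J e) - 1, and the indeterminate 'X
   for the number of spins. *)
Definition Zzero (H : mgraph) (gamma : edge H -> C) : {poly C} :=
  \sum_(A : {set edge H}) (\prod_(e in A) gamma e)%:P * 'X^(num_comp A).

Definition Xweight (q : nat) (beta : C) (m : 'rV[C]_q) : C :=
  \sum_(a < q) cexp (beta * m 0 a).

End Potts.

(* Main.v *)
(* Expanding each edge factor of the Boltzmann weight as
   1 + (e^(beta J_e) - 1) delta turns Z_ext into a sum over edge sets A. For a
   given A only the states constant on every component of (V(G), A) survive,
   and summing over them gives the product of the weights X over the components.
   Group the sets A by the partition P into components: such an A is a choice,
   independently in each block V of P, of a connected spanning subgraph of the
   subgraph induced by V, and the weighted sum over these choices is the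
   coefficient of q in the zero-field partition function of that subgraph. *)
Require Import Defs.
From mathcomp Require Import all_boot all_order all_algebra.
From mathcomp Require Import reals sequences exp trigo.
From mathcomp Require Import ring.

Set Implicit Arguments.
Unset Strict Implicit.
Unset Printing Implicit Defensive.

Import GRing.Theory Num.Theory.
Local Open Scope ring_scope.

(** [n_comp] counts the roots of the classes, so a count of one means that all points share their
    root. The first conjunct rules out the empty type, which has zero components. *)
Lemma n_comp_eq1P (T : finType) (e : rel T) : connect_sym e ->
  reflect ((exists x : T, true) /\ forall x y, connect e x y)
          (n_comp e T == 1%N).
Proof.
move=> sym_e; apply: (iffP idP) => [/eqP n1 | [[x _] conn]].
  have /pred0Pn[r _] : #|predI (roots e) T| != 0%N by rewrite [#|_|]n1.
  split=> [|x y]; first by exists r.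
  have /card_le1_eqP root_eq : (#|predI (roots e) T| <= 1)%N by rewrite [#|_|]n1.
  by rewrite -(root_connect sym_e); apply/eqP/root_eq; rewrite inE /= roots_root.
rewrite -(n_comp_connect sym_e x); apply/eqP/eq_n_comp_r => y.
by rewrite [in RHS]inE conn.
Qed.

(** * Components of a spanning subgraph as a vertex partition *)

Section Components.
Variable G : mgraph.
Implicit Types (A B : {set edge G}) (V : {set vert G}) (P : {set {set vert G}}).

Lemma adj_sym A : symmetric (adj A).
Proof. by move=> x y; apply: eq_existsb => e; rewrite orbC. Qed.

Lemma adj_ends A e : e \in A -> adj A (ends e).1 (ends e).2.
Proof. by move=> eA; apply/existsP; exists e; rewrite eA -surjective_pairing eqxx. Qed.

Lemma connect_adj_sym A : connect_sym (adj A).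
Proof. exact/sym_connect_sym/adj_sym. Qed.

Lemma connect_adj_equiv A : {in [set: vert G] & &, equivalence_rel (connect (adj A))}.
Proof.
move=> x y z _ _ _; split=> [|xy]; first exact: connect0.
exact: same_connect (connect_adj_sym A) _ _ xy z.
Qed.

Lemma connect_adj_mono A B : A \subset B ->
  subrel (connect (adj A)) (connect (adj B)).
Proof.
move=> /subsetP sAB; apply: connect_sub => x y /existsP[e /andP[eA exy]].
by apply/connect1/existsP; exists e; rewrite sAB.
Qed.

Definition inner_edges V : {set edge G} := [set e | inner_edge V e].

(* The connecting paths may leave V, unless A only has edges inside V. *)
Definition joins A V : bool := [forall x in V, forall y in V, connect (adj A) x y].

Lemma joinsP A V :
  reflect {in V &, forall x y, connect (adj A) x y} (joins A V).
Proof.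
apply: (iffP forall_inP) => [conn x y xV yV | conn x xV].
  exact: (forall_inP (conn x xV)).
by apply/forall_inP => y yV; exact: conn.
Qed.

Definition components A := equivalence_partition (connect (adj A)) [set: vert G].

Lemma components_partition A : partition (components A) [set: vert G].
Proof. exact/equivalence_partitionP/connect_adj_equiv. Qed.

Lemma pblock_components A x y : (y \in pblock (components A) x) = connect (adj A) x y.
Proof. by apply: pblock_equivalence_partition; rewrite ?inE //; apply: connect_adj_equiv. Qed.

Lemma components_eqP A P : partition P [set: vert G] ->
  reflect (forall x y, connect (adj A) x y = (y \in pblock P x)) (components A == P).
Proof.
move=> partP; apply: (iffP eqP) => [<- x y | conn].
  by rewrite pblock_components.
rewrite -(equivalence_partition_pblock partP) /components.
rewrite /equivalence_partition; apply: eq_imset => x.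
by apply/setP => y; rewrite !inE conn.
Qed.

Lemma partition_pblock_in P x : partition P [set: vert G] ->
  pblock P x \in P /\ x \in pblock P x.
Proof.
move=> /and3P[/eqP covP _ _].
by rewrite pblock_mem ?mem_pblock covP inE.
Qed.

Lemma inner_edge_stable V A e : closed (adj A) V -> e \in A ->
  ((ends e).1 \in V) = ((ends e).2 \in V).
Proof. by move=> clV eA; apply: clV; apply: adj_ends. Qed.

(** A path that starts in the closed set [V] never leaves it, so every edge along it has both ends
    in [V]. *)
Lemma connect_inner V A : closed (adj A) V ->
  {in V, forall x y, connect (adj A) x y -> connect (adj (A :&: inner_edges V)) x y}.
Proof.
move=> clV x xV y /connectP[p]; elim: p x xV => [|z p IHp] x xV /=.
  by move=> _ ->; apply: connect0.
case/andP=> xz path_p ylast.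
have zV : z \in V by rewrite -(clV _ _ xz).
apply: connect_trans (IHp z zV path_p ylast); apply: connect1.
case/existsP: xz => e /andP[eA exz]; apply/existsP; exists e.
rewrite !inE eA exz /= /inner_edge andbT.
by case/orP: exz => /eqP-> /=; rewrite xV zV.
Qed.

(** Trades a global condition on [A] for separate conditions on the traces [A :&: inner_edges V];
    this independence is what lets the sum over [A] factor over blocks. *)
Lemma components_eq A P : partition P [set: vert G] ->
  (components A == P) =
    (A \subset \bigcup_(V in P) inner_edges V) &&
    [forall V in P, joins (A :&: inner_edges V) V].
Proof.
move=> partP; have /and3P[covP trivP _] := partP.
apply: (sameP (components_eqP A partP)); apply: (iffP andP) => [[/subsetP subA /forall_inP conn] x y | conn]; last first.
  (* If the blocks are the components, no edge of [A] leaves a block; hence edges are inner and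
     paths stay inside. *)
  have clP V : V \in P -> closed (adj A) V.
    move=> VP; apply: intro_closed; first exact: connect_adj_sym.
    move=> x y xy xV; rewrite -(def_pblock trivP VP xV) -conn; exact: connect1.
  split.
    apply/subsetP => e eA; have [VP xV] := partition_pblock_in (ends e).1 partP.
    apply/bigcupP; exists (pblock P (ends e).1) => //.
    by rewrite inE /inner_edge -(inner_edge_stable (clP _ VP) eA) xV.
  apply/forall_inP => V VP; apply/joinsP => x y xV yV.
  apply: connect_inner => //; first exact: clP.
  by rewrite conn (def_pblock trivP VP xV).
apply/idP/idP => [|yV].
  (* Conversely, each edge of [A] is inner to some block, so a path from [x] cannot leave the block
     of [x]. *)
  have clP : closed (adj A) (pblock P x).
    apply: intro_closed; first exact: connect_adj_sym.
    move=> u v /existsP[e /andP[/subA /bigcupP[V VP]]].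
    rewrite inE => /andP[e1 e2] euv ux.
    have [uV vV] : u \in V /\ v \in V by case/orP: euv e1 e2 => /eqP->.
    by rewrite -(same_pblock trivP ux) (def_pblock trivP VP uV).
  move=> /(closed_connect clP) <-.
  by have [] := partition_pblock_in x partP.
have [VP xV] := partition_pblock_in x partP.
exact: connect_adj_mono (subsetIl _ _) _ _ (joinsP _ _ (conn _ VP) _ _ xV yV).
Qed.

End Components.

(** * Edge sets of an induced subgraph seen in the ambient graph *)

Section Induced.
Variables (G : mgraph) (V : {set vert G}).
Implicit Types B : {set edge (induced V)}.

Lemma edge_of_induced_inj : injective (@edge_of_induced G V).
Proof. exact: val_inj. Qed.

Lemma edge_of_induced_inner (e : edge (induced V)) :
  edge_of_induced e \in inner_edges V.
Proof. rewrite inE; exact: (valP (e : induced_edge V)). Qed.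

Lemma ends_induced (e : edge (induced V)) :
  ends (edge_of_induced e) = (val (ends e).1, val (ends e).2).
Proof.
rewrite [ends e]/= /induced_ends /edge_of_induced.
by case: (andP _) => h1 h2 /=; case: (ends _).
Qed.

Lemma adj_induced B (x y : vert (induced V)) :
  adj B x y = adj (@edge_of_induced G V @: B) (val x) (val y).
Proof.
apply/existsP/existsP => [[e /andP[eB exy]] | [_ /andP[/imsetP[e eB ->] exy]]].
  exists (edge_of_induced e); rewrite imset_f //= ends_induced.
  by case/orP: exy => /eqP-> /=; rewrite eqxx ?orbT.
exists e; rewrite eB andTb; move: exy; rewrite ends_induced.
by case/orP=> /eqP[/val_inj e1 /val_inj e2];
   rewrite [ends e]surjective_pairing e1 e2 eqxx ?orbT.
Qed.

(** Edges in the image of [B] have both ends in [V], so an ambient path along them from a vertex of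
    [V] lifts step by step. *)
Lemma connect_induced B (x y : vert (induced V)) :
  connect (adj B) x y = connect (adj (@edge_of_induced G V @: B)) (val x) (val y).
Proof.
apply/idP/idP.
  case/connectP=> p; elim: p x => [|z p IHp] x /=; first by move=> _ ->.
  case/andP=> xz pp ylast; apply: connect_trans (IHp z pp ylast).
  by apply: connect1; rewrite -adj_induced.
case/connectP=> p; elim: p x => [|z p IHp] x /=.
  by move=> _ /val_inj->.
case/andP=> xz pp ylast.
have zV : z \in V.
  case/existsP: xz => _ /andP[/imsetP[e _ ->]]; rewrite ends_induced.
  by case/orP=> /eqP[]; [move=> _ <- | move=> <- _]; apply: valP.
apply: connect_trans (IHp (exist _ z zV) pp ylast).
by apply: connect1; rewrite adj_induced.
Qed.

(** Nonemptiness matters: for empty [V] there are zero components, while [joins] holds vacuously. *)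
Lemma num_comp_induced_eq1 B : V != set0 ->
  (num_comp B == 1%N) = joins (@edge_of_induced G V @: B) V.
Proof.
case/set0Pn=> v0 v0V.
apply/(n_comp_eq1P (connect_adj_sym B))/joinsP => [[_ conn] x y xV yV | conn].
  by have := conn (exist _ x xV) (exist _ y yV); rewrite connect_induced.
split=> [|x y]; first by exists (exist _ v0 v0V).
by rewrite connect_induced; apply: conn; apply: valP.
Qed.

Lemma imset_edge_of_induced : @edge_of_induced G V @: [set: edge (induced V)] = inner_edges V.
Proof.
apply/setP => e; apply/imsetP/idP => [[e' _ ->] | ]; first exact: edge_of_induced_inner.
by rewrite inE => eV; exists (exist _ e eV).
Qed.

End Induced.

(** Each component is already joined by the edges of [A] inside it, and adding the other inner edges
    keeps it joined. Thus grouping edge sets by components meets only connected partitions. *)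
Lemma components_connected (G : mgraph) (A : {set edge G}) :
  connected_partition (components A).
Proof.
have partA := components_partition A; rewrite /connected_partition partA.
apply/forall_inP => V VA; rewrite /connected_graph num_comp_induced_eq1; last first.
  by apply: contraTneq VA => ->; case/and3P: partA.
have := components_eq A partA; rewrite eqxx => /esym/andP[_ /forall_inP/(_ V VA)].
move=> /joinsP conn; apply/joinsP => x y xV yV; rewrite imset_edge_of_induced.
exact: connect_adj_mono (subsetIr _ _) _ _ (conn x y xV yV).
Qed.

(** * Factoring sums over states and over edge sets along blocks *)

Section SpinSums.
Variable (K : comNzRingType) (G : mgraph).
Implicit Types P : {set {set vert G}}.

(** A state constant on blocks amounts to one spin chosen per block; distributivity does the
    rest. *)
Lemma sum_blockwise_constant q (hq : (0 < q)%N) (w : vert G -> 'I_q -> K) P :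
    partition P [set: vert G] ->
  \sum_(s : {ffun vert G -> 'I_q} | [forall x, forall y in pblock P x, s x == s y])
     \prod_v w v (s v) =
  \prod_(V in P) \sum_a \prod_(v in V) w v a.
Proof.
move=> partP; have /and3P[_ trivP P0] := partP; pose a0 := Ordinal hq.
(* The expansion runs over functions on all vertex sets with default value [a0] off [P]. [colour]
   reads the spin at a picked vertex of each block and uses the same default, so that it inverts
   [spread]. *)
rewrite (big_distr_big_dep a0).
pose spread (f : {ffun {set vert G} -> 'I_q}) := [ffun v => f (pblock P v)].
pose colour (s : {ffun vert G -> 'I_q}) : {ffun {set vert G} -> 'I_q} :=
  [ffun V => if V \in P then if [pick v in V] is Some v then s v else a0 else a0].
have pickP V (VP : V \in P) : exists2 v, v \in V & [pick v in V] = Some v.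
  case: pickP => [v vV | V0]; first by exists v.
  by case/negP: P0; suff <- : V = set0 by []; apply/setP=> v; rewrite V0 inE.
rewrite (reindex_onto spread colour) => [|s /forallP s_const]; last first.
  apply/ffunP=> v; rewrite !ffunE; have [VP vV] := partition_pblock_in v partP.
  rewrite VP; have [u uV ->] := pickP _ VP.
  exact/esym/eqP/(forall_inP (s_const v)).
apply: eq_big => [f | f _].
  apply/andP/pfamilyP => [[_ /eqP<-] | [supp _]]; split=> //.
  - by apply/subsetP=> V; rewrite !inE ffunE; case: (V \in P); rewrite ?eqxx.
  - apply/forallP=> x; apply/forall_inP=> y xy; rewrite !ffunE.
    by rewrite (same_pblock trivP xy).
  apply/eqP/ffunP=> V; rewrite ffunE; case: ifPn => [VP | VnP].
    by have [v vV ->] := pickP _ VP; rewrite ffunE (def_pblock trivP VP vV).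
  by apply/esym/eqP; apply: contraNT VnP; apply: (subsetP supp).
transitivity (\prod_(v in [set: vert G]) w v (spread f v)).
  by apply: eq_bigl => v; rewrite inE.
rewrite (set_partition_big _ partP); apply: eq_bigr => V VP.
by apply: eq_bigr => v vV; rewrite ffunE (def_pblock trivP VP vV).
Qed.

(** Equality of spins across edges propagates along paths. *)
Lemma monochromatic_components q (A : {set edge G}) (s : {ffun vert G -> 'I_q}) :
  [forall e in A, s (ends e).1 == s (ends e).2] =
  [forall x, forall y in pblock (components A) x, s x == s y].
Proof.
apply/forall_inP/forallP => [s_eq x | s_const e eA].
  apply/forall_inP=> y; rewrite pblock_components.
  case/connectP=> p; elim: p x => [|z p IHp] x /=; first by move=> _ ->.
  case/andP=> /existsP[e /andP[/s_eq exz exz']] path_p ylast.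
  have /eqP-> : s x == s z by case/orP: exz' exz => /eqP-> //; rewrite eq_sym.
  exact: IHp.
apply: (forall_inP (s_const _)); rewrite pblock_components.
exact/connect1/adj_ends.
Qed.

(** The product of Kronecker deltas is the indicator of the states that are constant on
    components. *)
Lemma sum_monochromatic q (hq : (0 < q)%N) (w : vert G -> 'I_q -> K) (A : {set edge G}) :
  \sum_(s : {ffun vert G -> 'I_q})
     (\prod_(e in A) (s (ends e).1 == s (ends e).2)%:R) * \prod_v w v (s v) =
  \prod_(V in components A) \sum_a \prod_(v in V) w v a.
Proof.
rewrite -sum_blockwise_constant ?components_partition // [RHS]big_mkcond.
apply: eq_bigr => s _; rewrite -monochromatic_components.
case: ifPn => [/forall_inP s_eq | /forall_inPn[e eA /negbTE s_neq]].
  by rewrite big1 ?mul1r // => e /s_eq->.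
by rewrite (bigD1 e) //= s_neq !mul0r.
Qed.

(** Taking unions ([glue]) and traces on blocks ([cut]) are inverse bijections between blockwise
    choices and edge sets with components [P]. *)
Lemma prod_connected_subgraphs (g : edge G -> K) P :
    partition P [set: vert G] ->
  \prod_(V in P) \sum_(B : {set edge G} | (B \subset inner_edges V) && joins B V)
     \prod_(e in B) g e =
  \sum_(A : {set edge G} | components A == P) \prod_(e in A) g e.
Proof.
move=> partP; have /and3P[_ trivP _] := partP.
have inner_inj V W e : V \in P -> W \in P ->
    e \in inner_edges V -> e \in inner_edges W -> V = W.
  rewrite !inE => VP WP /andP[eV _] /andP[eW _].
  by rewrite -(def_pblock trivP VP eV) (def_pblock trivP WP eW).
rewrite (big_distr_big_dep set0).
pose glue (f : {ffun {set vert G} -> {set edge G}}) := \bigcup_V f V.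
pose cut (A : {set edge G}) : {ffun {set vert G} -> {set edge G}} :=
  [ffun V => if V \in P then A :&: inner_edges V else set0].
rewrite [RHS](reindex_onto glue cut) => [|A]; last first.
  rewrite components_eq // => /andP[/subsetP subA _]; apply/setP=> e.
  apply/bigcupP/idP => [[V _] | eA].
    by rewrite ffunE; case: ifP; rewrite inE // => _ /andP[].
  have /bigcupP[V VP eV] := subA _ eA.
  by exists V; rewrite // ffunE VP inE eA.
(* Distinct blocks share no inner edge, so the trace of the union on a block returns the set chosen
   there. *)
have glue_in f V : f \in pfamily set0 (mem P)
      (fun V (B : {set edge G}) => (B \subset inner_edges V) && joins B V) ->
    V \in P -> glue f :&: inner_edges V = f V.
  move=> /pfamilyP[supp fP] VP; apply/setP=> e; rewrite inE.
  have /andP[/subsetP sfV _] := fP V VP.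
  apply/andP/idP => [[/bigcupP[W _ eW] eV] | eV]; last first.
    by split; [apply/bigcupP; exists V | exact: sfV].
  have WP : W \in P by apply: (subsetP supp); apply: contraTneq eW => ->; rewrite inE.
  have /andP[/subsetP sfW _] := fP W WP.
  by rewrite (inner_inj V W e) // sfW.
apply: eq_big => [f | f fF].
  apply/idP/andP => [fF | []].
    have /pfamilyP[supp fP] := fF; split.
      rewrite components_eq //; apply/andP; split.
        apply/bigcupsP=> V _; have [VP | VnP] := boolP (V \in P).
          by apply: subset_trans (bigcup_sup V VP); case/andP: (fP V VP).
        suff -> : f V = set0 by exact: sub0set.
        by apply/eqP; apply: contraNT VnP; apply: (subsetP supp).
      by apply/forall_inP=> V VP; rewrite glue_in //; case/andP: (fP V VP).
    apply/eqP/ffunP=> V; rewrite ffunE; case: ifPn => [|VnP]; first exact: glue_in.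
    by apply/esym/eqP; apply: contraNT VnP; apply: (subsetP supp).
  rewrite components_eq // => /andP[_ /forall_inP conn] /eqP<-.
  apply/pfamilyP; split=> [|V VP].
    by apply/subsetP=> V; rewrite !inE ffunE; case: (V \in P); rewrite ?eqxx.
  by rewrite ffunE VP unfold_in subsetIr conn.
have fP := glue_in _ _ fF; have /pfamilyP[/subsetP supp _] := fF.
rewrite partition_disjoint_bigcup => [|V W neqVW]; last first.
  rewrite -setI_eq0; apply: contraNT neqVW => /set0Pn[e /setIP[eV eW]].
  have VP : V \in P by apply: supp; apply: contraTneq eV => ->; rewrite inE.
  have WP : W \in P by apply: supp; apply: contraTneq eW => ->; rewrite inE.
  rewrite -(fP V) // in eV; rewrite -(fP W) // in eW.
  by apply/eqP/(inner_inj V W e) => //; [case/setIP: eV | case/setIP: eW].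
(* Off [P] the chosen set is the default [set0], which contributes a factor 1. *)
rewrite big_mkcond; apply: eq_bigr => V _; case: ifPn => // VnP.
have -> : f V = set0 by apply/eqP; apply: contraNT VnP; apply: supp.
by rewrite big_set0.
Qed.

End SpinSums.

(** * Boltzmann weights and the coefficient of q *)

Section Potts.
Variable R : realType.
Local Notation C := (complex R).

Lemma cexp0 : cexp (0 : C) = 1.
Proof. by rewrite /cexp /= expR0 cos0 sin0 mulr1 mulr0. Qed.

Lemma cexpD (x y : C) : cexp (x + y) = cexp x * cexp y.
Proof.
case: x y => [a b] [c d]; rewrite /cexp /= expRD cosD sinD.
by apply/eqP; rewrite eq_complex /=; apply/andP; split; apply/eqP; ring.
Qed.

Lemma cexp_sum (I : Type) (r : seq I) (P : pred I) (F : I -> C) :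
  cexp (\sum_(i <- r | P i) F i) = \prod_(i <- r | P i) cexp (F i).
Proof. exact: (big_morph (@cexp R) cexpD cexp0). Qed.

(** The two-term form of an edge factor, valid because the Kronecker delta is 0 or 1. *)
Lemma cexp_mulrb (x : C) (b : bool) : cexp (x * b%:R) = (cexp x - 1) * b%:R + 1.
Proof. by case: b; rewrite ?mulr1 ?subrK // !mulr0 cexp0 add0r. Qed.

Lemma Xweight_sum q (beta : C) (I : finType) (V : {set I}) (M : I -> 'rV[C]_q) :
  Xweight beta (\sum_(v in V) M v) = \sum_a \prod_(v in V) cexp (beta * M v 0 a).
Proof. by apply: eq_bigr => a _; rewrite summxE mulr_sumr cexp_sum. Qed.

Lemma boltzmann_weight (G : mgraph) q (beta : C) (J : edge G -> C)
    (M : vert G -> 'rV[C]_q) (s : {ffun vert G -> 'I_q}) :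
  cexp (- beta * hamiltonian J M s) =
  \sum_(A : {set edge G}) (\prod_(e in A) (cexp (beta * J e) - 1)) *
    ((\prod_(e in A) (s (ends e).1 == s (ends e).2)%:R) *
     \prod_v cexp (beta * M v 0 (s v))).
Proof.
rewrite /hamiltonian -opprD mulrNN mulrDr cexpD !mulr_sumr !cexp_sum.
under eq_bigr do rewrite mulrA cexp_mulrb.
(* [A] collects the edges at which the summand other than 1 is chosen. *)
rewrite bigA_distr mulr_suml; apply: eq_bigr => A _.
rewrite -big_mkcond big_split /= -mulrA; congr (_ * (_ * _)).
apply: eq_bigr => v _; rewrite (bigD1 (s v)) //= eqxx mulr1 big1 ?addr0 // => a.
by move=> /negbTE->; rewrite mulr0.
Qed.

(** Only edge sets with exactly one component contribute to this coefficient. Image and preimage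
    under [edge_of_induced] match them with the sets of inner edges that join [V]. *)
Lemma Zzero_coef1 (G : mgraph) (V : {set vert G}) (g : edge G -> C) :
    V != set0 ->
  (Zzero (fun e : edge (induced V) => g (edge_of_induced e)))`_1 =
  \sum_(B : {set edge G} | (B \subset inner_edges V) && joins B V)
     \prod_(e in B) g e.
Proof.
move=> V0; rewrite coef_sum; have inj_val := @edge_of_induced_inj G V.
rewrite (reindex_onto (fun B' : {set edge (induced V)} => @edge_of_induced G V @: B')
  (fun B => @edge_of_induced G V @^-1: B)) => [|B /andP[/subsetP sBV _]]; last first.
  apply/setP=> e; apply/imsetP/idP => [[e' + ->] | eB]; first by rewrite inE.
  have := sBV e eB; rewrite -imset_edge_of_induced => /imsetP[e' _ def_e].
  by exists e'; rewrite // inE -def_e.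
rewrite [RHS]big_mkcond; apply: eq_bigr => B' _.
rewrite coefCM coefXn eq_sym num_comp_induced_eq1 // mulr_natr mulrb.
have -> : @edge_of_induced G V @^-1: (@edge_of_induced G V @: B') = B'.
  by apply/setP=> e; rewrite inE mem_imset.
rewrite -[inner_edges V]imset_edge_of_induced imsetS ?subsetT // eqxx andbT.
by case: ifP => // _; rewrite big_imset //= => ? ? _ _; exact: inj_val.
Qed.

End Potts.

Theorem theorem3p1 (R : realType) (beta : complex R) (q : nat) (hq : (1 <= q)%N)
    (G : mgraph) (J : edge G -> complex R) (M : vert G -> 'rV[complex R]_q) :
  Zext beta J M =
    \sum_(P : {set {set vert G}} | connected_partition P)
      (\prod_(V in P) Xweight beta (\sum_(v in V) M v)) *
      \prod_(V in P)
        (Zzero (fun e : edge (induced V) =>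
                  cexp (beta * J (edge_of_induced e)) - 1))`_1.
Proof.
rewrite /Zext (eq_bigr _ (fun s _ => boltzmann_weight beta J M s)) exchange_big /=.
rewrite (partition_big (@components G) (@connected_partition G)) => [|A _]; last first.
  exact: components_connected.
apply: eq_bigr => P /andP[partP _]; have /and3P[_ _ P0] := partP.
(* [P0] says that the empty set is not a block, which gives the nonemptiness that [Zzero_coef1]
   requires. *)
rewrite [X in _ * X](eq_bigr _ (fun V (VP : V \in P) =>
  Zzero_coef1 (fun e => cexp (beta * J e) - 1) (memPn P0 V VP))).
rewrite prod_connected_subgraphs // mulr_sumr.
apply: eq_bigr => A /eqP <-; rewrite -mulr_sumr mulrC.
rewrite (sum_monochromatic hq (fun v a => cexp (beta * M v 0 a))); congr (_ * _).
by apply: eq_bigr => V _; rewrite Xweight_sum.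
Qed.
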